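(* Let $a,b$ be positive integers with $b\ge2$, $N\in\mathbb N$ and $0\le n\le N-1$. (i) If $N\equiv n\pmod2$, then $\zeta(a,b;\delta_N/\delta_n)=\det\big(B(i+j+n-1)\big)_{1\le i,j\le\frac{N-n}{2}}$. (ii) If $N\not\equiv n\pmod2$, then $\zeta(a,b;\delta_N/\delta_n)=(-1)^{\frac12n(n+1)}\det\big(B(i+j-n-2)\big)_{1\le i,j\le\frac{N+n+1}{2}}$.
   Context: Skew diagrams: for partitions $\lambda=(\lambda_1,\dots,\lambda_h)$, $\mu=(\mu_1,\dots,\mu_r)$ with $\mu_j<\lambda_j$ ($\mu_j=0$ for $j>r$), $D(\lambda/\mu)=\{(i,j):1\le i\le h,\mu_i<j\le\lambda_i\}$; corners are cells $(i,j)$ with $(i,j+1),(i+1,j)\notin D$. For a filling $\mathbf k=(k_{i,j})$ by positive integers with entries $\ge2$ at corners, $\zeta(\mathbf k)=\sum\prod m_{i,j}^{-k_{i,j}}$ over fillings $(m_{i,j})$ by positive integers, strictly increasing down columns and weakly increasing along rows. The diagram is checkerboardable if there is a (unique) filling $\mathbf k_{a,b}$ with $k_{i,j}$ depending only on the parity of $i-j$, equal to $a$ on one parity class and $b$ on the other, and equal to $b$ at all corners; $\zeta(a,b;\lambda/\mu):=\zeta(\mathbf k_{a,b})$. $\delta_n=(n,n-1,\dots,1)$, $\delta_0=\delta_{-1}=\emptyset$. $B(n)=\zeta(a,b;\delta_{n+1}/\delta_{n-1})$ for $n\ge0$ and $B(n)=0$ for $n<0$. *)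

(* Defs.v *)
From mathcomp Require Import all_boot all_order all_algebra.
From mathcomp Require Import zify.
From mathcomp Require Import all_classical all_reals all_analysis.

Set Implicit Arguments.
Unset Strict Implicit.
Unset Printing Implicit Defensive.

Import Order.TTheory GRing.Theory Num.Theory.

Local Open Scope classical_set_scope.
Local Open Scope ring_scope.

(* A partition is its sequence of parts. Row i >= 1 of la has length
   nth 0 la i.-1; cells are pairs (row, column), both numbered from 1. *)
Definition skew_diagram (la mu : seq nat) : seq (nat * nat) :=
  [seq (i, j) | i <- iota 1 (size la),
                j <- iota (nth 0 mu i.-1).+1 (nth 0 la i.-1 - nth 0 mu i.-1)]%N.

Lemma mem_skew_diagram (la mu : seq nat) (i j : nat) :
  ((i, j) \in skew_diagram la mu) =
  [&& 1 <= i <= size la, nth 0 mu i.-1 < j & j <= nth 0 la i.-1]%N.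
Proof.
apply/allpairsPdep/and3P => /=.
- move=> [i' [j' [+ + [-> ->]]]]; rewrite !mem_iota => /andP[i1 ih] /andP[mj jl].
  by split; [rewrite i1 -ltnS -[(size la).+1]add1n | | lia].
- move=> [/andP[i1 ih] mj jl]; exists i, j; rewrite !mem_iota; split => //.
    by rewrite i1 add1n ltnS.
  by rewrite mj /=; lia.
Qed.

Definition is_corner (D : seq (nat * nat)) (c : nat * nat) : bool :=
  [&& c \in D, (c.1, c.2.+1) \notin D & (c.1.+1, c.2) \notin D].

Definition filling (D : seq (nat * nat)) := {ffun seq_sub D -> nat}.

Definition ssyt (D : seq (nat * nat)) : set (filling D) := fun m =>
  [/\ forall c, (0 < m c)%N,
      forall c d, ((val c).2 = (val d).2 -> (val c).1 < (val d).1 -> m c < m d)%N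
    & forall c d, ((val c).1 = (val d).1 -> (val c).2 < (val d).2 -> m c <= m d)%N].

(* The terms are nonnegative, so the sum always makes sense in the extended
   reals; it is +oo exactly when the series diverges. *)
Definition schur_zeta (R : realType) (D : seq (nat * nat)) (k : filling D) :
    \bar R :=
  \esum_(m in @ssyt D) (\prod_(c : seq_sub D) ((m c)%:R ^- k c))%:E.

(* The parity of i - j is that of i + j. *)
Definition is_checkerboard (a b : nat) (D : seq (nat * nat)) (k : filling D) :
    Prop :=
  (exists p : bool, forall c,
     k c = if odd ((val c).1 + (val c).2) == p then b else a) /\
  (forall c, is_corner D (val c) -> k c = b).

(* The constant filling 1 is a junk value for diagrams that are not
   checkerboardable. *)
Definition checkerboard_filling (a b : nat) (D : seq (nat * nat)) : filling D :=
  xget [ffun => 1%N] [set k | is_checkerboard a b k].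

Definition checkerboard_zeta (R : realType) (a b : nat) (la mu : seq nat) :
    \bar R :=
  schur_zeta R (checkerboard_filling a b (skew_diagram la mu)).

Definition delta (n : int) : seq nat :=
  if n is Posz m then rev (iota 1 m) else [::].

Definition B (R : realType) (a b : nat) (n : int) : R :=
  if 0 <= n then fine (checkerboard_zeta R a b (delta (n + 1)) (delta (n - 1)))
  else 0.

(* Main.v *)
Require Import Defs.
From mathcomp Require Import all_boot all_order all_algebra.
From mathcomp Require Import perm zify ring lra.
From mathcomp Require Import all_classical all_reals all_analysis.

(** Truncate all entries of the tableaux at some bound. The exponent of a cell
    depends only on its content, and two adjacent diagonals of a tableau
    interlace: given a diagonal, each entry of the preceding one ranges
    independently over an interval. Summing the diagonals away one after the
    other, the partial sum is a determinant throughout: multilinearity moves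
    the sums over the intervals inside, and differences of adjacent rows turn
    interval sums into the sums that build ribbons cell by cell. A diagonal that
    gains a cell contributes a column of ones (the start of a ribbon), one that
    loses a cell contributes a row of completed ribbon sums. In the end all rows
    are ribbon sums, which gives the Hankel determinant for every truncation.
    The truncated ribbon sums are bounded because
    [1/m * sum_(u > m) 1/u^2 <= 1/m^2], so letting the bound go to infinity
    proves the formulas. *)

Set Implicit Arguments.
Unset Strict Implicit.
Unset Printing Implicit Defensive.

Import Order.TTheory GRing.Theory Num.Theory.
Import numFieldNormedType.Exports.

Local Open Scope classical_set_scope.
Local Open Scope ring_scope.

(** * Determinants *)

Section Det.
Variable R : comNzRingType.

(** These simultaneous row differences are a left multiplication by a lower unitriangular matrix,
    which has determinant 1. *)
Lemma det_sub_pred_row (r q : nat) (c : nat -> nat -> R) :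
  \det (\matrix_(j < r, i < r) (c j i - if (q < j)%N then c j.-1 i else 0)) =
  \det (\matrix_(j < r, i < r) c j i).
Proof.
pose T : 'M[R]_r := \matrix_(j, k)
  ((j == k)%:R - ((q < j)%N && (k.+1 == j :> nat))%:R).
have trigT : is_trig_mx T.
  apply/is_trig_mxP => i j ij; rewrite mxE.
  have -> : (i == j) = false by apply/eqP => e; move: ij; rewrite e ltnn.
  have -> : (j.+1 == i :> nat) = false by lia.
  by rewrite andbF subrr.
have detT : \det T = 1.
  rewrite det_trig// big1// => i _; rewrite mxE eqxx.
  have -> : (i.+1 == i :> nat) = false by lia.
  by rewrite andbF subr0.
rewrite -[RHS]mul1r -detT -det_mulmx; congr (\det _).
apply/matrixP => j i; rewrite !mxE.
under eq_bigr do rewrite !mxE mulrBl.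
rewrite sumrB; congr (_ - _).
  rewrite (bigD1 j)//= eqxx mul1r big1 ?addr0// => k kj.
  by rewrite eq_sym (negbTE kj) mul0r.
case: ifP => qj; last by rewrite big1// => k _; rewrite mul0r.
have jr : (j.-1 < r)%N by have := ltn_ord j; lia.
rewrite (bigD1 (Ordinal jr))//=.
have -> : (j.-1.+1 == j :> nat) = true by lia.
rewrite mul1r big1 ?addr0// => k kj.
have -> : (k.+1 == j :> nat) = false.
  by apply/eqP => e; case/eqP: kj; apply/val_inj; rewrite /= -e.
by rewrite mul0r.
Qed.

(** Here the multiplier is upper unitriangular; the last row has no successor and stays as it is. *)
Lemma det_sub_succ_row (r q : nat) (c : nat -> nat -> R) :
  \det (\matrix_(j < r, i < r)
          (c j i - if (q <= j)%N && (j.+1 < r)%N then c j.+1 i else 0)) =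
  \det (\matrix_(j < r, i < r) c j i).
Proof.
pose T : 'M[R]_r := \matrix_(j, k)
  ((j == k)%:R - ((q <= j)%N && (k == j.+1 :> nat))%:R).
have trigT : is_trig_mx T^T.
  apply/is_trig_mxP => i j ij; rewrite !mxE.
  have -> : (j == i) = false by apply/eqP => e; move: ij; rewrite e ltnn.
  have -> : (i == j.+1 :> nat) = false by lia.
  by rewrite andbF subrr.
have detT : \det T = 1.
  rewrite -det_tr det_trig// big1// => i _; rewrite !mxE eqxx.
  have -> : (i == i.+1 :> nat) = false by lia.
  by rewrite andbF subr0.
rewrite -[RHS]mul1r -detT -det_mulmx; congr (\det _).
apply/matrixP => j i; rewrite !mxE.
under eq_bigr do rewrite !mxE mulrBl.
rewrite sumrB; congr (_ - _).
  rewrite (bigD1 j)//= eqxx mul1r big1 ?addr0// => k kj.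
  by rewrite eq_sym (negbTE kj) mul0r.
case: (leqP q j) => qj /=; last by rewrite big1// => k _; rewrite mul0r.
case: ltnP => jr.
  rewrite (bigD1 (Ordinal jr))//= eqxx mul1r big1 ?addr0// => k kj.
  have -> : (k == j.+1 :> nat) = false.
    by apply/eqP => e; case/eqP: kj; apply/val_inj.
  by rewrite mul0r.
rewrite big1// => k _.
have -> : (k == j.+1 :> nat) = false by have := ltn_ord k; lia.
by rewrite mul0r.
Qed.

Lemma prod_ord_nat (n lo hi : nat) (F : nat -> R) : (hi <= n)%N ->
  \prod_(r < n | (lo <= r < hi)%N) F r = \prod_(lo <= r < hi) F r.
Proof.
move=> hn; rewrite (big_nat_widen _ _ n)// big_geq_mkord.
by apply: eq_bigl => r; rewrite /= andbC.
Qed.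

(* Each summation variable occurs in exactly one row of the determinant, so
   multilinearity moves the sums inside. *)
Lemma sum_det_intervals (N Mx r q lo hi : nat) (lb ub : nat -> nat)
    (w : nat -> R) (C A : nat -> nat -> R) :
  (lo <= hi <= N.+1)%N -> r = (q + (hi - lo))%N ->
  \sum_(h : {ffun 'I_N.+1 -> 'I_Mx.+1})
    (\prod_(k < N.+1) (if (lo <= k < hi)%N
        then ((lb k < h k <= ub k)%N)%:R * w (h k) else (h k == 0%N :> nat)%:R))
    * \det (\matrix_(j < r, i < r)
        if (j < q)%N then C j i else A i (h (inord (lo + (j - q))))) =
  \det (\matrix_(j < r, i < r)
        if (j < q)%N then C j i else
        \sum_(m < Mx.+1 | (lb (lo + (j - q)) < m <= ub (lo + (j - q)))%N)
           w m * A i m).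
Proof.
move=> /andP[lohi hiN] rE.
rewrite /determinant; under eq_bigr do rewrite mulr_sumr.
rewrite exchange_big /=; apply: eq_bigr => s _.
under eq_bigr do rewrite mulrCA.
rewrite -mulr_sumr; congr (_ * _).
(* Extending the permutation to all naturals lets the rows [j >= q] be reindexed by
   [k = lo + (j - q)]; the default 0 is only a filler. *)
pose sn (j : nat) : nat := if insub j : option 'I_r is Some j' then s j' : nat else 0%N.
have snE (j : 'I_r) : sn j = s j by rewrite /sn valK.
pose S (k : nat) : R := \sum_(m < Mx.+1 | (lb k < m <= ub k)%N)
  w m * A (sn (q + (k - lo))%N) m.
have split_rows (Phi : nat -> nat -> R) :
    \prod_(j < r) (if (j < q)%N then C j (s j) else Phi (lo + (j - q))%N (sn j)) =
    \prod_(j < r | (j < q)%N) C j (s j) *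
    \prod_(k < N.+1 | (lo <= k < hi)%N) Phi k (sn (q + (k - lo))%N).
  rewrite (bigID (fun j : 'I_r => (j < q)%N)) /=; congr (_ * _).
    by apply: eq_bigr => j ->.
  rewrite (prod_ord_nat _ (fun k => Phi k (sn (q + (k - lo))%N)))//.
  transitivity (\prod_(q <= j < r) Phi (lo + (j - q))%N (sn j)).
    rewrite -(prod_ord_nat _ (fun j => Phi (lo + (j - q))%N (sn j)) (leqnn r)).
    apply: eq_big => [j|j /negbTE ->//].
    by rewrite -leqNgt ltn_ord andbT.
  have shift (d l u : nat) (F : nat -> R) : (u - d = l)%N ->
      \prod_(d <= k < u) F k = \prod_(0 <= k < l) F (k + d)%N.
    by move=> <-; rewrite -{1}[d]add0n big_addn.
  rewrite (shift q (hi - lo)%N); last lia.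
  rewrite (shift lo (hi - lo)%N)//.
  by apply: eq_bigr => k _; rewrite !addnK addnC (addnC q).
transitivity (\prod_(j < r | (j < q)%N) C j (s j) *
    \prod_(k < N.+1 | (lo <= k < hi)%N) S k); last first.
  rewrite -(split_rows (fun k i => \sum_(m < Mx.+1 | (lb k < m <= ub k)%N)
     w m * A i m)).
  by apply: eq_bigr => j _; rewrite mxE snE.
have E (h : {ffun 'I_N.+1 -> 'I_Mx.+1}) :
   \prod_(j < r) (\matrix_(j < r, i < r)
        if (j < q)%N then C j i else A i (h (inord (lo + (j - q))))) j (s j) =
   \prod_(j < r | (j < q)%N) C j (s j) *
    \prod_(k < N.+1 | (lo <= k < hi)%N) A (sn (q + (k - lo))%N) (h k).
  transitivity (\prod_(j < r) (if (j < q)%N then C j (s j) else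
     (fun k i => A i (h (inord k))) (lo + (j - q))%N (sn j))).
    by apply: eq_bigr => j _; rewrite mxE snE.
  rewrite (split_rows (fun k i => A i (h (inord k)))); congr (_ * _).
  by apply: eq_bigr => k _; rewrite inord_val.
under eq_bigr do rewrite E mulrCA.
rewrite -mulr_sumr; congr (_ * _).
rewrite [RHS]big_mkcond /=.
(* Distributivity turns the sum over all [h] into a product of sums over single coordinates; a
   coordinate pinned to 0 gives the factor 1. *)
transitivity (\prod_(k < N.+1) \sum_(m < Mx.+1)
   (if (lo <= k < hi)%N then (((lb k < m <= ub k)%N)%:R * w m) *
       A (sn (q + (k - lo))%N) m else (m == 0%N :> nat)%:R)).
  rewrite bigA_distr_bigA; apply: eq_bigr => h _.
  rewrite [X in _ * X]big_mkcond -big_split /=; apply: eq_bigr => k _.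
  by case: ifP => // _; rewrite mulr1.
apply: eq_bigr => k _; case: ifP => _.
  rewrite /S [RHS]big_mkcond; apply: eq_bigr => m _.
  by case: ifP; rewrite ?mul1r// !mul0r.
by rewrite (bigD1 ord0)//= big1 ?addr0// => m;
  rewrite -val_eqE /= => /negbTE ->.
Qed.

End Det.

(** * Partial sums over diagonals *)

Section Ribbon.
Variables (R : comNzRingType) (Mx : nat) (x y : nat -> R).

(* [ribbon_down e 0] is the truncated value of [B e], read along the ribbon:
   [x] weighs the [b]-cells, [y] the [a]-cells, and [ribbon_up e v] sums over
   the first [2 e] cells, the next one being a [b]-cell with entry [v]. *)
Fixpoint ribbon_up (e v : nat) : R :=
  if e is e'.+1 then
    \sum_(m < Mx.+1 | (0 < m <= v)%N)
       y m * \sum_(u < Mx.+1 | (m < u)%N) x u * ribbon_up e' u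
  else 1.

Definition ribbon_down (e v : nat) : R :=
  \sum_(u < Mx.+1 | (v < u)%N) x u * ribbon_up e u.

(** [ribbon_up e.+1] sums over an initial segment and [ribbon_down] over a tail, so an interval sum
    is a difference of two values. *)
Lemma ribbon_up_interval (e lo hi : nat) : (lo <= hi)%N ->
  \sum_(m < Mx.+1 | (lo < m <= hi)%N) y m * ribbon_down e m =
  ribbon_up e.+1 hi - ribbon_up e.+1 lo.
Proof.
move=> lohi; apply/eqP; rewrite -subr_eq opprK eq_sym; apply/eqP => /=.
rewrite (bigID (fun m : 'I_Mx.+1 => (lo < m)%N)) /=; congr (_ + _).
  by apply: eq_bigl => m; lia.
by apply: eq_bigl => m; lia.
Qed.

Lemma ribbon_down_interval (e lo hi : nat) : (lo <= hi)%N ->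
  \sum_(m < Mx.+1 | (lo < m <= hi)%N) x m * ribbon_up e m =
  ribbon_down e lo - ribbon_down e hi.
Proof.
move=> lohi; apply/eqP; rewrite -subr_eq opprK eq_sym; apply/eqP.
rewrite /ribbon_down (bigID (fun m : 'I_Mx.+1 => (m <= hi)%N)) /=.
by congr (_ + _); apply: eq_bigl => m; lia.
Qed.

(** With [ribbon_downM], this makes the boundary defaults 0 and [Mx] drop out of the row differences
    at the ends of a layer. *)
Lemma ribbon_up0 e : ribbon_up e.+1 0 = 0.
Proof. by rewrite /= big_pred0// => m; lia. Qed.

Lemma ribbon_downM e : ribbon_down e Mx = 0.
Proof.
by rewrite /ribbon_down big_pred0// => m; have := ltn_ord m; lia.
Qed.

End Ribbon.

(** * Summing away the diagonals: the determinant at each layer *)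

Section Layers.
Variables (R : comNzRingType) (N r Mx : nat) (x y : nat -> R).

Local Notation state := {ffun 'I_N.+1 -> 'I_Mx.+1}.
Local Notation up := (ribbon_up Mx x y).
Local Notation down := (ribbon_down Mx x y).

(* Layer [l] is the diagonal of content [l - (N - 1)]; its cells are indexed by
   their row, from [layer_lo l] (included) to [layer_hi l] (excluded), and it
   has exponent [b] iff [l] is even. Seen as non-intersecting paths, one path
   starts on each of the layers [0, 2, .., 2 (r - 1)] and one path ends on each
   of the layers [2 (N - r), .., 2 (N - 1)]; [src t] counts the paths started
   up to layer [2 t] and [snk t] those that ended strictly before it. *)
Definition src (t : nat) : nat := minn t.+1 r.
Definition snk (t : nat) : nat := (t + r - N)%N.

Definition layer_hi (l : nat) : nat := (N.+1 - uphalf l)%N.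
Definition layer_lo (l : nat) : nat :=
  (layer_hi l - (src l./2 - snk (uphalf l)))%N.

(* An entry outside the layer puts no constraint on its neighbours: it counts
   as 0 above the layer and as the truncation bound below it. *)
Definition ext (l : nat) (g : state) (k : nat) : nat :=
  if (k < layer_lo l)%N then 0%N
  else if (k < layer_hi l)%N then g (inord k) : nat else Mx.

(** The bounds on [h k] are its upper and right neighbours, which both lie on the next layer. Rows
    outside the layer are pinned to 0, so that each tableau is counted once. *)
Definition layer_kernel (l : nat) (h g : state) : R :=
  \prod_(k < N.+1)
    (if (layer_lo l <= k < layer_hi l)%N
     then ((ext l.+1 g k.-1 < h k <= ext l.+1 g k)%N)%:R *
          (if odd l then y else x) (h k)
     else (h k == 0%N :> nat)%:R).

Fixpoint layer_sum (l : nat) (g : state) : R :=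
  if l is l'.+1 then \sum_(h : state) layer_kernel l' h g * layer_sum l' h
  else 1.

Definition ext_mono (l : nat) (g : state) : Prop :=
  forall k, (ext l g k <= ext l g k.+1)%N.

(** A nonzero kernel interlaces: [h k <= ext l.+1 g k < h k.+1]. Hence only monotone states matter,
    for which interval sums telescope. *)
Lemma layer_kernel_mono l h g : layer_kernel l h g = 0 \/ ext_mono l h.
Proof.
have [/forallP H|] := boolP [forall k : 'I_N.+1,
  (layer_lo l <= k < layer_hi l)%N ==>
  (ext l.+1 g k.-1 < h k <= ext l.+1 g k)%N].
  2: {
  rewrite negb_forall => /existsP[k]; rewrite negb_imply => /andP[kl kn].
  left; rewrite /layer_kernel (bigD1 k)//= kl (negbTE kn).
  by rewrite !mul0r. }
right=> k; rewrite {1}/ext; case: (ltnP k (layer_lo l)) => // lok.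
case: (ltnP k (layer_hi l)) => hik; rewrite /ext.
  have -> : (k.+1 < layer_lo l)%N = false by lia.
  case: (ltnP k.+1 (layer_hi l)) => hik1; last by rewrite -ltnS.
  have kN : (k.+1 < N.+1)%N by move: hik1; rewrite /layer_hi; lia.
  have := H (inord k); have := H (inord k.+1).
  rewrite !inordK//; last by lia.
  have -> : (layer_lo l <= k < layer_hi l)%N by lia.
  have -> : (layer_lo l <= k.+1 < layer_hi l)%N by lia.
  by rewrite /= => /andP[h1 _] /andP[_ h2]; exact: leq_trans h2 (ltnW h1).
have -> : (k.+1 < layer_lo l)%N = false by lia.
by have -> : (k.+1 < layer_hi l)%N = false by lia.
Qed.

(* The ribbon sum from the source [S - 1 - i] to the sink [N - r + j]; it is 0
   when the sink comes before the source. *)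
Definition sink_entry (S j i : nat) : R :=
  if (S <= N - r + j + 1 + i)%N then down (N - r + j + 1 + i - S) 0 else 0.

(** The rows before [q] belong to ended paths, the others to the entries of the current diagonal;
    the columns are the started paths, latest first. *)
Definition layer_det (S q lo : nat) (A : nat -> nat -> R) (g : state) : R :=
  \det (\matrix_(j < S, i < S)
     if (j < q)%N then sink_entry S j i
     else A i (g (inord (lo + (j - q))))).

(** Collects the cofactor signs: the column added with source [s] is expanded at its row of index
    [snk s]. *)
Definition layer_sign (S : nat) : R := (-1) ^+ (\sum_(s < S) snk s)%N.

Lemma layer_hi_even t : layer_hi t.*2 = (N.+1 - t)%N.
Proof. by rewrite /layer_hi uphalf_double. Qed.

Lemma layer_hi_odd t : layer_hi t.*2.+1 = (N - t)%N.
Proof. by rewrite /layer_hi /= doubleK; lia. Qed.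

Lemma layer_lo_even t : layer_lo t.*2 = (N.+1 - t - (src t - snk t))%N.
Proof. by rewrite /layer_lo layer_hi_even uphalf_double doubleK. Qed.

Lemma layer_lo_odd t : layer_lo t.*2.+1 = (N - t - (src t - snk t.+1))%N.
Proof. by rewrite /layer_lo layer_hi_odd uphalfE -doubleS /= !doubleK uphalf_double. Qed.

(** The common start of both steps: one diagonal is summed away by multilinearity, and each of its
    rows becomes an interval sum. *)
Lemma layer_kernel_sum (l S q : nat) (A : nat -> nat -> R) (g : state) :
  (layer_lo l <= layer_hi l)%N -> S = (q + (layer_hi l - layer_lo l))%N ->
  (forall h : state, ext_mono l h ->
     layer_sum l h = layer_sign S * layer_det S q (layer_lo l) A h) ->
  layer_sum l.+1 g = layer_sign S * \det (\matrix_(j < S, i < S)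
     if (j < q)%N then sink_entry S j i else
     \sum_(m < Mx.+1 | (ext l.+1 g (layer_lo l + (j - q)).-1 < m
                        <= ext l.+1 g (layer_lo l + (j - q)))%N)
       (if odd l then y else x) m * A i m).
Proof.
move=> lohi SE IH.
have hiN : (layer_lo l <= layer_hi l <= N.+1)%N by rewrite lohi /layer_hi; lia.
rewrite -(@sum_det_intervals _ N Mx S q _ _ (fun k => ext l.+1 g k.-1)
  (ext l.+1 g) (if odd l then y else x) (sink_entry S) A hiN SE).
rewrite mulr_sumr /=; apply: eq_bigr => h _.
rewrite -/(layer_kernel l h g) -/(layer_det S q (layer_lo l) A h).
have [->|/IH ->] := layer_kernel_mono l h g; first by rewrite !mul0r mulr0.
by rewrite mulrCA.
Qed.

Hypothesis r_bounds : (0 < r <= N)%N.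

(** The interval sums of [up] are differences of [down] at consecutive entries, that is, of each row
    with the next one. If a path ends here, its row is evaluated at the default 0 and becomes a
    completed ribbon sum. *)
Lemma layer_sum_odd_step t (g : state) : (t < N)%N ->
  (forall h : state, ext_mono t.*2 h ->
     layer_sum t.*2 h = layer_sign (src t) *
       layer_det (src t) (snk t) (layer_lo t.*2) (fun i => up (t.+1 - r + i)) h) ->
  ext_mono t.*2.+1 g ->
  layer_sum t.*2.+1 g = layer_sign (src t) *
    layer_det (src t) (snk t.+1) (layer_lo t.*2.+1)
      (fun i => down (t.+1 - r + i)) g.
Proof.
move=> tN IH gm; rewrite (layer_kernel_sum _ _ _ IH).
- congr (_ * _).
  pose c j i := if (j < snk t)%N then sink_entry (src t) j i
     else down (t.+1 - r + i) (ext t.*2.+1 g (layer_lo t.*2 + (j - snk t)).-1).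
  transitivity (\det (\matrix_(j < src t, i < src t) c j i)).
    rewrite -(det_sub_succ_row _ (snk t)); congr (\det _).
    apply/matrixP => j i; rewrite !mxE /c; have jS := ltn_ord j.
    case: (ltnP j (snk t)) => jq.
      by rewrite /= subr0.
    rewrite odd_double ribbon_down_interval; last first.
      have -> : (layer_lo t.*2 + (j - snk t) =
                 (layer_lo t.*2 + (j - snk t)).-1.+1)%N.
        by rewrite prednK// layer_lo_even; move: tN jS; rewrite /src /snk; lia.
      exact: gm.
    congr (_ - _) => /=; case: ltnP => jS1.
      have -> : (j.+1 < snk t)%N = false by lia.
      by congr (down _ (ext _ _ _)); lia.
    (* The upper bound for the last row lies past layer [t.*2.+1], so there is nothing to
       subtract. *)
    have -> : ext t.*2.+1 g (layer_lo t.*2 + (j - snk t)) = Mx.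
      rewrite /ext layer_lo_odd layer_hi_odd layer_lo_even.
      have -> : (N.+1 - t - (src t - snk t) + (j - snk t) <
                 N - t - (src t - snk t.+1))%N = false.
        by move: tN jS jS1; rewrite /src /snk; lia.
      have -> : (N.+1 - t - (src t - snk t) + (j - snk t) < N - t)%N = false.
        by move: tN jS jS1; rewrite /src /snk; lia.
      by [].
    by rewrite ribbon_downM.
  congr (\det _); apply/matrixP => j i; rewrite !mxE /c.
  have jS := ltn_ord j.
  case: (ltnP j (snk t)) => jq.
    by have -> : (j < snk t.+1)%N by move: jq; rewrite /snk; lia.
  case: (ltnP j (snk t.+1)) => jq1.
    (* At most one path ends between the two layers; this is its row. *)
    have jE : (j : nat) = snk t by move: jq jq1; rewrite /snk; lia.
    rewrite /sink_entry.
    have -> : (src t <= N - r + j + 1 + i)%N.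
      by move: tN jE jq1; rewrite /src /snk; lia.
    have -> : ext t.*2.+1 g (layer_lo t.*2 + (j - snk t)).-1 = 0%N.
      rewrite /ext layer_lo_odd layer_lo_even.
      have -> // : ((N.+1 - t - (src t - snk t) + (j - snk t)).-1 <
                   N - t - (src t - snk t.+1))%N.
      by move: tN jE jq1 jS; rewrite /src /snk; lia.
    by congr down; move: tN jE jq1; rewrite /src /snk; lia.
  congr down.
  have kE : (layer_lo t.*2 + (j - snk t)).-1 =
            (layer_lo t.*2.+1 + (j - snk t.+1))%N.
    by rewrite layer_lo_even layer_lo_odd; move: tN jq jq1 jS;
      rewrite /src /snk; lia.
  rewrite kE /ext; have -> : (layer_lo t.*2.+1 + (j - snk t.+1) <
     layer_lo t.*2.+1)%N = false by lia.
  have -> // : (layer_lo t.*2.+1 + (j - snk t.+1) < layer_hi t.*2.+1)%N.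
  by rewrite layer_lo_odd layer_hi_odd; move: tN jq jq1 jS; rewrite /src /snk;
    lia.
- by rewrite layer_lo_even layer_hi_even; lia.
- by rewrite layer_lo_even layer_hi_even; move: tN; rewrite /src /snk; lia.
Qed.

(* When a path starts, the determinant grows by a column of ones; after
   differencing the rows, this column has a single nonzero entry, in row
   [snk t.+1], which produces the sign. *)
Lemma layer_sum_even_step t (g : state) : (t.+1 < N)%N ->
  (forall h : state, ext_mono t.*2.+1 h ->
     layer_sum t.*2.+1 h = layer_sign (src t) *
       layer_det (src t) (snk t.+1) (layer_lo t.*2.+1)
         (fun i => down (t.+1 - r + i)) h) ->
  ext_mono t.+1.*2 g ->
  layer_sum t.+1.*2 g = layer_sign (src t.+1) *
    layer_det (src t.+1) (snk t.+1) (layer_lo t.+1.*2)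
      (fun i => up (t.+2 - r + i)) g.
Proof.
move=> tN IH gm; rewrite doubleS (layer_kernel_sum _ _ _ IH) -?doubleS.
- have oddE : odd t.*2.+1 by rewrite /= odd_double.
  have inner (j : 'I_(src t)) (i : nat) : (snk t.+1 <= j)%N ->
    \sum_(m < Mx.+1 | (ext t.+1.*2 g (layer_lo t.*2.+1 + (j - snk t.+1)).-1 < m
              <= ext t.+1.*2 g (layer_lo t.*2.+1 + (j - snk t.+1)))%N)
     (if odd t.*2.+1 then y else x) m * down (t.+1 - r + i) m =
    up (t.+1 - r + i).+1 (ext t.+1.*2 g (layer_lo t.*2.+1 + (j - snk t.+1))) -
    up (t.+1 - r + i).+1 (ext t.+1.*2 g (layer_lo t.*2.+1 + (j - snk t.+1)).-1).
    move=> jq; rewrite oddE ribbon_up_interval//.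
    have -> : (layer_lo t.*2.+1 + (j - snk t.+1) =
               (layer_lo t.*2.+1 + (j - snk t.+1)).-1.+1)%N.
      rewrite prednK// layer_lo_odd.
      by have := ltn_ord j; move: tN jq; rewrite /src /snk; lia.
    exact: gm.
  have extE k : (layer_lo t.+1.*2 <= k < layer_hi t.+1.*2)%N ->
      ext t.+1.*2 g k = g (inord k).
    by case/andP => k1 k2; rewrite /ext k2 ltnNge k1.
  (* Either a path starts on this layer, or all [r] paths have started already. *)
  case: (ltnP t.+1 r) => tr.
    have SE : src t.+1 = (src t).+1 by rewrite /src; lia.
    have tE : src t = t.+1 by rewrite /src; lia.
    have loE : layer_lo t.*2.+1 = (layer_lo t.+1.*2).+1.
      by rewrite layer_lo_odd layer_lo_even; move: tN tr; rewrite /src /snk;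
        lia.
    rewrite SE /layer_sign big_ord_recr /= exprD -mulrA; congr (_ * _).
    pose c j i := if (j < snk t.+1)%N then sink_entry (src t).+1 j i
       else up i (ext t.+1.*2 g (layer_lo t.+1.*2 + (j - snk t.+1))).
    have -> : layer_det (src t).+1 (snk t.+1) (layer_lo t.+1.*2)
        (fun i => up (t.+2 - r + i)) g =
        \det (\matrix_(j < (src t).+1, i < (src t).+1) c j i).
      congr (\det _); apply/matrixP => j i; rewrite !mxE /c.
      case: ltnP => // jq; have -> : (t.+2 - r + i = i)%N by lia.
      rewrite extE//; have := ltn_ord j; rewrite layer_hi_even layer_lo_even.
      by move: tN tr jq; rewrite /src /snk; lia.
    (* In column 0 the sink entries vanish, since the new source comes after those sinks, and the
       remaining entries are [up 0 = 1]. Differencing leaves a single 1. *)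
    rewrite -(det_sub_pred_row _ (snk t.+1)) (expand_det_col _ ord0).
    have qS : (snk t.+1 < (src t).+1)%N.
      by move: tN tr; rewrite /src /snk; lia.
    rewrite (bigD1 (Ordinal qS))//= [X in _ + X]big1 ?addr0; last first.
      move=> j jq; rewrite !mxE /c.
      have jq' : (j != snk t.+1 :> nat).
        by apply: contraNneq jq => e; apply/eqP/val_inj.
      case: (ltnP j (snk t.+1)) => jq1.
        rewrite /sink_entry.
        have -> : ((src t).+1 <= N - r + j + 1 + (ord0 : 'I_(src t).+1))%N = false.
          by move: tN tr jq1; rewrite /= /src /snk; lia.
        have -> : (snk t.+1 < j)%N = false by lia.
        by rewrite subr0 mul0r.
      have -> : (snk t.+1 < j)%N by lia.
      have -> : (j.-1 < snk t.+1)%N = false by lia.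
      by rewrite /= subrr mul0r.
    (* The cofactor sign cancels the new factor of [layer_sign]. *)
    have sE : snk (src t) = snk t.+1 by rewrite tE.
    rewrite !mxE /c /= ltnn subr0 mul1r /cofactor /= addn0 sE mulrA -exprD.
    rewrite -signr_odd oddD addbb expr0 mul1r.
    congr (\det _); apply/matrixP => j i; rewrite !mxE /=.
    rewrite /bump leq0n add1n.
    case: (ltnP j (snk t.+1)) => jq.
      rewrite add0n; have -> : (snk t.+1 < j)%N = false by lia.
      rewrite jq subr0 /sink_entry.
      have -> : (N - r + j + 1 + i.+1 - (src t).+1 = N - r + j + 1 + i - src t)%N by lia.
      by have -> : ((src t).+1 <= N - r + j + 1 + i.+1 = (src t <= N - r + j + 1 + i))%N by lia.
    rewrite inner// add1n ltnS jq [j.+1.-1]/=.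
    have -> : (j.+1 < snk t.+1)%N = false by lia.
    have -> : (j < snk t.+1)%N = false by lia.
    have -> : (t.+1 - r + i = i)%N by lia.
    rewrite loE addSn -addnS -subSn//.
    by have -> : (layer_lo t.+1.*2 + (j.+1 - snk t.+1)).-1 =
        (layer_lo t.+1.*2 + (j - snk t.+1))%N by lia.
  (* Without a new path the size stays the same: each active row is a difference with the preceding
     one, and the first subtracts [up _ 0 = 0]. *)
  have SE : src t.+1 = src t by rewrite /src; lia.
  have loE : layer_lo t.*2.+1 = layer_lo t.+1.*2.
    by rewrite layer_lo_odd layer_lo_even; move: tN tr; rewrite /src /snk; lia.
  rewrite SE; congr (_ * _).
  pose c j i := if (j < snk t.+1)%N then sink_entry (src t) j i
       else up (t.+1 - r + i).+1
              (ext t.+1.*2 g (layer_lo t.+1.*2 + (j - snk t.+1))).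
  transitivity (\det (\matrix_(j < src t, i < src t) c j i)).
    rewrite -(det_sub_pred_row _ (snk t.+1)); congr (\det _).
    apply/matrixP => j i; rewrite !mxE /c.
    case: (ltnP j (snk t.+1)) => jq.
      by have -> : (snk t.+1 < j)%N = false; [lia | rewrite subr0].
    rewrite inner// loE; congr (_ - _).
    case: ltnP => jq1.
      have -> : (j.-1 < snk t.+1)%N = false by lia.
      by congr (up _ (ext _ _ _)); lia.
    have -> : ext t.+1.*2 g (layer_lo t.+1.*2 + (j - snk t.+1)).-1 = 0%N.
      rewrite /ext.
      have -> // : ((layer_lo t.+1.*2 + (j - snk t.+1)).-1 < layer_lo t.+1.*2)%N.
      have := ltn_ord j; rewrite layer_lo_even.
      by move: tN tr jq jq1; rewrite /src /snk; lia.
    by rewrite ribbon_up0.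
  congr (\det _); apply/matrixP => j i; rewrite !mxE /c.
  case: ltnP => // jq; have -> : (t.+2 - r + i = (t.+1 - r + i).+1)%N by lia.
  rewrite extE//; have := ltn_ord j; rewrite layer_hi_even layer_lo_even.
  by move: tN tr jq; rewrite /src /snk; lia.
- by rewrite layer_lo_odd layer_hi_odd; lia.
- by rewrite layer_lo_odd layer_hi_odd; move: tN; rewrite /src /snk; lia.
Qed.

Lemma layer_sum_even t (g : state) : (t < N)%N -> ext_mono t.*2 g ->
  layer_sum t.*2 g = layer_sign (src t) *
    layer_det (src t) (snk t) (layer_lo t.*2) (fun i => up (t.+1 - r + i)) g.
Proof.
elim: t g => [|t IH] g tN gm.
  have -> : src 0 = 1%N by rewrite /src; lia.
  rewrite /layer_sign /layer_det big_ord1 det_mx11 !mxE.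
  have snk0 : snk 0 = 0%N by rewrite /snk; lia.
  have e0 : (1 - r + (ord0 : 'I_1) = 0)%N by rewrite /=; lia.
  by rewrite e0 /= snk0 mul1r.
apply: layer_sum_even_step => // h hm.
by apply: layer_sum_odd_step => // [|h' hm']; [lia | apply: IH => //; lia].
Qed.

(** Past the last diagonal the layer is empty and every path has ended, so only sink entries remain,
    whatever [g] is. *)
Lemma layer_sum_total (g : state) :
  layer_sum N.*2.-1 g = layer_sign r *
    \det (\matrix_(j < r, i < r) sink_entry r j i).
Proof.
have [t NE] : exists t, N = t.+1 by exists N.-1; lia.
have -> : N.*2.-1 = t.*2.+1 by rewrite NE; lia.
have SE : src t = r by rewrite /src; lia.
have empty : layer_lo t.*2.+1 = layer_hi t.*2.+1.
  by rewrite layer_lo_odd layer_hi_odd SE /snk; lia.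
rewrite layer_sum_odd_step; first last.
- by move=> k; rewrite /ext empty; case: ltnP => //; case: ltnP => //; lia.
- by move=> h hm; apply: layer_sum_even => //; lia.
- by lia.
rewrite SE; congr (_ * \det _); apply/matrixP => j i; rewrite !mxE.
by have -> : (j < snk t.+1)%N by have := ltn_ord j; rewrite /snk; lia.
Qed.

End Layers.

(** * Tableaux as chains of diagonals *)

Section Chains.
Variables (R : comNzRingType) (N r Mx : nat) (x y : nat -> R).
Local Notation state := {ffun 'I_N.+1 -> 'I_Mx.+1}.

Definition chain_nth (L : nat) (G : {ffun 'I_L -> state}) (g : state) (l : nat) :
    state :=
  if insub l : option 'I_L is Some i then G i else g.

(** Unrolls the recursion: the last layer of a chain is the outermost summation variable, and [g]
    closes the chain. *)
Lemma layer_sum_chains (L : nat) (g : state) :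
  \sum_(G : {ffun 'I_L -> state})
    \prod_(l < L) layer_kernel r x y l (G l) (chain_nth G g l.+1) =
  layer_sum r x y L g.
Proof.
elim: L g => [|L IH] g.
  under eq_bigr do rewrite big_ord0.
  by rewrite sumr_const card_ffun card_ord expn0.
pose glue (p : state * {ffun 'I_L -> state}) : {ffun 'I_L.+1 -> state} :=
  [ffun i => if unlift ord_max i is Some j then p.2 j else p.1].
pose unglue (G : {ffun 'I_L.+1 -> state}) : state * {ffun 'I_L -> state} :=
  (G ord_max, [ffun j => G (lift ord_max j)]).
have glueK : cancel glue unglue.
  move=> [h G]; rewrite /unglue /glue ffunE unlift_none; congr (_, _).
  by apply/ffunP => j; rewrite !ffunE liftK.
have unglueK : cancel unglue glue.
  move=> G; apply/ffunP => i; rewrite ffunE /unglue /=.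
  by case: unliftP => [j ->|->//]; rewrite ffunE.
rewrite (reindex glue) /=; last by exists unglue => p _.
rewrite -(pair_bigA _ (fun h G => \prod_(l < L.+1)
   layer_kernel r x y l (glue (h, G) l) (chain_nth (glue (h, G)) g l.+1))) /=.
apply: eq_bigr => h _; rewrite -IH mulr_sumr; apply: eq_bigr => G _.
have glue_lt (j : 'I_L) : glue (h, G) (widen_ord (leqnSn L) j) = G j.
  rewrite ffunE; have -> : widen_ord (leqnSn L) j = lift ord_max j.
    by apply/val_inj; rewrite /= /bump leqNgt ltn_ord.
  by rewrite liftK.
have glue_max : glue (h, G) ord_max = h by rewrite ffunE unlift_none.
rewrite big_ord_recr /= mulrC glue_max; congr (layer_kernel _ _ _ _ _ _ * _).
  by rewrite /chain_nth insubF //= ltnn.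
apply: eq_bigr => l _; rewrite glue_lt; congr layer_kernel.
rewrite /chain_nth.
have [lL|Ll] := ltnP l.+1 L.
  rewrite (insubT (fun i => i < L)%N lL) (insubT (fun i => i < L.+1)%N (leqW lL)).
  by rewrite -(glue_lt (Sub l.+1 lL)); congr (glue _ _); apply/val_inj.
have -> : (l : nat).+1 = L by have := ltn_ord l; lia.
by rewrite (insubT (fun i => i < L.+1)%N (ltnSn L)) insubF ?ltnn// -[RHS]glue_max.
Qed.

End Chains.

(** * Tableaux of staircase shape and their diagonals *)

Section Staircase.
Variables (N n : nat) (D : seq (nat * nat)).
Hypothesis memD : forall i j, ((i, j) \in D) =
  [&& 0 < i, 0 < j, n + 2 <= i + j & i + j <= N + 1]%N.

Definition entry (f : filling D) (p : nat * nat) : nat :=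
  if insub p : option (seq_sub D) is Some c then f c else 0%N.

Lemma entryE (f : filling D) (c : seq_sub D) : entry f (val c) = f c.
Proof. by rewrite /entry valK. Qed.

(** Only neighbours on the next diagonal are compared; the defaults for missing ones match those of
    [ext]. *)
Definition locally_ssyt (Mx : nat) (f : filling D) (i j : nat) : bool :=
  ((if (i.-1, j) \in D then entry f (i.-1, j) else 0) < entry f (i, j) <=
   (if (i, j.+1) \in D then entry f (i, j.+1) else Mx))%N.

(** Rows and columns of [D] have no gaps, so the comparisons of neighbours chain up. *)
Lemma ssyt_locallyP (Mx : nat) (f : filling D) : (forall c, (f c <= Mx)%N) ->
  ssyt f <-> (forall i j, (i, j) \in D -> locally_ssyt Mx f i j).
Proof.
move=> fM; split => [[f_gt0 f_col f_row] i j ijD|loc].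
  have ent (p : nat * nat) (pD : p \in D) : entry f p = f (SeqSub pD).
    by rewrite -entryE.
  rewrite /locally_ssyt (ent _ ijD); apply/andP; split.
    case: ifPn => [pD|_]; last exact: f_gt0.
    rewrite (ent _ pD); apply: f_col => //=; move: ijD; rewrite memD; lia.
  case: ifPn => [pD|_]; last exact: fM.
  by rewrite (ent _ pD); apply: f_row => /=.
have col j i d : (i, j) \in D -> (i + d.+1, j)%N \in D ->
    (entry f (i, j) < entry f (i + d.+1, j)%N)%N.
  move=> iD; elim: d => [|d IH] dD.
    by have /andP[+ _] := loc _ _ dD; rewrite addn1 /= iD.
  have d'D : (i + d.+1, j)%N \in D by move: iD dD; rewrite !memD; lia.
  apply: ltn_trans (IH d'D) _.
  by have /andP[+ _] := loc _ _ dD; rewrite addnS /= d'D.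
have row i j d : (i, j) \in D -> (i, j + d)%N \in D ->
    (entry f (i, j) <= entry f (i, j + d))%N.
  move=> jD; elim: d => [|d IH] dD; first by rewrite addn0.
  have d'D : (i, j + d)%N \in D by move: jD dD; rewrite !memD; lia.
  apply: leq_trans (IH d'D) _.
  by have /andP[_] := loc _ _ d'D; rewrite -addnS dD.
split.
- move=> [[i j] /= cD]; rewrite -entryE /=.
  by have /andP[+ _] := loc _ _ cD; exact: leq_trans.
- move=> [[i j] cD] [[i' j'] dD] /= e lt; rewrite -!entryE /=.
  subst j'; have -> : i' = (i + (i' - i.+1).+1)%N by lia.
  apply: col => //.
  by have <- : i' = (i + (i' - i.+1).+1)%N by lia.
- move=> [[i j] cD] [[i' j'] dD] /= e lt; rewrite -!entryE /=.
  subst i'; have -> : j' = (j + (j' - j))%N by lia.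
  apply: row => //.
  by have <- : j' = (j + (j' - j))%N by lia.
Qed.

Variable r : nat.
Hypotheses (nN : (n < N)%N)
  (rE : N = (n + r.*2)%N \/ r.*2 = (N + n + 1)%N).

Local Notation L := (N.*2.-1).

(* If [k + l < N], truncated subtraction gives the column 0, outside [D]. *)
Definition layer_cell (l k : nat) : nat * nat := (k, k + l + 1 - N)%N.

(** On every diagonal the number of open paths is the number of cells, in both cases of [rE]. *)
Lemma mem_layer (l k : nat) : (l <= L)%N ->
  (layer_lo N r l <= k < layer_hi N l)%N = (layer_cell l k \in D).
Proof.
move=> lL; rewrite /layer_cell memD.
have [t [->|->]] : exists t, l = t.*2 \/ l = t.*2.+1.
- by exists l./2; lia.
- rewrite layer_lo_even layer_hi_even /src /snk; lia.
- rewrite layer_lo_odd layer_hi_odd /src /snk; lia.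
Qed.

Lemma cell_layer_subproof (c : seq_sub D) :
  ((val c).2 + N - 1 - (val c).1 < L)%N.
Proof. by case: c => -[i j] /= cD; move: cD; rewrite memD; lia. Qed.

Lemma cell_row_subproof (c : seq_sub D) : ((val c).1 < N.+1)%N.
Proof. by case: c => -[i j] /= cD; move: cD; rewrite memD; lia. Qed.

Definition cell_layer (c : seq_sub D) : 'I_L := Ordinal (cell_layer_subproof c).
Definition cell_row (c : seq_sub D) : 'I_N.+1 := Ordinal (cell_row_subproof c).

Lemma layer_cellK (c : seq_sub D) :
  layer_cell (cell_layer c) (cell_row c) = val c.
Proof.
case: c => -[i j] cD; rewrite /layer_cell /=; congr (_, _).
by move: cD; rewrite memD; lia.
Qed.

Lemma cell_layerK (l : 'I_L) (k : 'I_N.+1) (c : seq_sub D) :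
  val c = layer_cell l k -> cell_layer c = l /\ cell_row c = k.
Proof.
move=> cE; have cD := valP c; rewrite cE /layer_cell memD in cD.
by split; apply/val_inj; rewrite /= cE //=; lia.
Qed.

Variables (R : comNzRingType) (Mx : nat) (x y : nat -> R).
Local Notation state := {ffun 'I_N.+1 -> 'I_Mx.+1}.

Definition nat_filling (m : {ffun seq_sub D -> 'I_Mx.+1}) : filling D :=
  [ffun c => m c : nat].

Definition filling_of_chain (G : {ffun 'I_L -> state}) :
    {ffun seq_sub D -> 'I_Mx.+1} :=
  [ffun c => G (cell_layer c) (cell_row c)].

Definition chain_of_filling (m : {ffun seq_sub D -> 'I_Mx.+1}) :
    {ffun 'I_L -> state} :=
  [ffun l : 'I_L => [ffun k : 'I_N.+1 =>
     if insub (layer_cell l k) : option (seq_sub D) is Some c then m c else ord0]].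

Lemma chain_of_fillingK : cancel chain_of_filling filling_of_chain.
Proof.
move=> m; apply/ffunP => c; rewrite !ffunE layer_cellK.
by rewrite valK.
Qed.

Lemma entry_filling_of_chain (G : {ffun 'I_L -> state}) (l : 'I_L) (k : 'I_N.+1) :
  layer_cell l k \in D ->
  entry (nat_filling (filling_of_chain G)) (layer_cell l k) = G l k.
Proof.
move=> cD; rewrite /entry insubT !ffunE.
by have [-> ->] := @cell_layerK l k (SeqSub cD) erefl.
Qed.

Local Notation g0 := ([ffun => ord0] : state).

Lemma ext_chain_nth (G : {ffun 'I_L -> state}) (l k : nat) :
  (l < L)%N -> layer_cell l.+1 k \in D ->
  ext r l.+1 (chain_nth G g0 l.+1) k =
  entry (nat_filling (filling_of_chain G)) (layer_cell l.+1 k).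
Proof.
move=> lL cD; rewrite /ext.
have := cD; rewrite -mem_layer// => /andP[klo khi].
rewrite ltnNge klo khi /=.
have lL1 : (l.+1 < L)%N by move: cD; rewrite /layer_cell memD; lia.
have kN : (k < N.+1)%N by move: cD; rewrite /layer_cell memD; lia.
rewrite -[X in layer_cell X _]/(nat_of_ord (Ordinal lL1)).
rewrite -[X in layer_cell _ X]/(nat_of_ord (Ordinal kN)).
rewrite entry_filling_of_chain//= /chain_nth (insubT (fun i => i < L)%N lL1).
by congr (nat_of_ord (G _ _)); apply/val_inj; rewrite /= ?inordK.
Qed.

Lemma layer_lo_succ (l : nat) : (l < L)%N -> (layer_lo N r l.+1 <= layer_lo N r l)%N.
Proof.
move=> lL; have [t [lE|lE]] : exists t, l = t.*2 \/ l = t.*2.+1.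
- by exists l./2; lia.
- by rewrite lE layer_lo_odd layer_lo_even /src /snk; lia.
- by rewrite lE -doubleS layer_lo_odd layer_lo_even /src /snk; lia.
Qed.

(** A missing upper neighbour falls before the next layer and a missing right neighbour past it, so
    [ext] takes the right default. *)
Lemma layer_locally_ssyt (G : {ffun 'I_L -> state}) (l : 'I_L) (k : 'I_N.+1) :
  layer_cell l k \in D ->
  (ext r l.+1 (chain_nth G g0 l.+1) k.-1 < G l k
     <= ext r l.+1 (chain_nth G g0 l.+1) k)%N =
  locally_ssyt Mx (nat_filling (filling_of_chain G)) k (k + l + 1 - N).
Proof.
move=> cD; rewrite /locally_ssyt -/(layer_cell l k) entry_filling_of_chain//.
have lL := ltn_ord l.
have := cD; rewrite -mem_layer ?(ltnW lL)// => /andP[klo khi].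
have up_cell : (k.-1, k + l + 1 - N)%N = layer_cell l.+1 k.-1.
  by move: cD; rewrite /layer_cell memD => cD; congr (_, _); lia.
have right_cell : (k : nat, (k + l + 1 - N).+1)%N = layer_cell l.+1 k.
  by move: cD; rewrite /layer_cell memD => cD; congr (_, _); lia.
have hiS : (layer_hi N l <= (layer_hi N l.+1).+1)%N.
  by rewrite /layer_hi; lia.
rewrite up_cell right_cell; congr (_ < _ <= _)%N.
- case: ifPn => [/ext_chain_nth ->//|].
  have k_gt0 : (0 < k)%N by move: cD; rewrite /layer_cell memD => /and4P[].
  have khi' : (k.-1 < layer_hi N l.+1)%N by lia.
  by rewrite -mem_layer// /ext khi' andbT -ltnNge => ->.
- case: ifPn => [/ext_chain_nth ->//|].
  have klo' : (layer_lo N r l.+1 <= k)%N by apply: leq_trans klo;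
    exact: layer_lo_succ.
  by rewrite -mem_layer// /ext klo' /= [(_ < layer_lo _ _ _)%N]ltnNge klo' => /negbTE ->.
Qed.

Definition staircase_sum : R :=
  \sum_(m : {ffun seq_sub D -> 'I_Mx.+1} | `[< ssyt (nat_filling m) >])
    \prod_c (if odd ((val c).1 + (val c).2) == odd N.+1 then x else y) (m c).

Lemma staircase_sum_layers : staircase_sum = layer_sum r x y L g0.
Proof.
rewrite -layer_sum_chains /staircase_sum.
(* This is a one-sided inverse: chains with nonzero entries outside [D] are excluded on the left and
   have a vanishing kernel on the right. *)
rewrite (reindex_onto filling_of_chain chain_of_filling) => [|m _]; last first.
  exact: chain_of_fillingK.
rewrite big_mkcond; apply: eq_bigr => G _.
have bound c : (nat_filling (filling_of_chain G) c <= Mx)%N.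
  by rewrite ffunE -ltnS.
have okE : (`[< ssyt (nat_filling (filling_of_chain G)) >] &&
     (chain_of_filling (filling_of_chain G) == G)) =
   [forall l : 'I_L, [forall k : 'I_N.+1,
     if (layer_lo N r l <= k < layer_hi N l)%N
     then (ext r l.+1 (chain_nth G g0 l.+1) k.-1 < G l k
            <= ext r l.+1 (chain_nth G g0 l.+1) k)%N
     else G l k == 0%N :> nat]].
  apply/andP/forallP => [[/asboolP/(ssyt_locallyP bound) loc /eqP GE] l|ok].
    apply/forallP => k; rewrite mem_layer; last exact: ltnW.
    case: ifPn => cD; first by rewrite layer_locally_ssyt//; exact: loc.
    by rewrite -GE !ffunE insubF //; exact: negbTE.
  split.
    apply/asboolP/(ssyt_locallyP bound) => i j ijD.
    pose c : seq_sub D := SeqSub ijD.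
    have cE := layer_cellK c.
    have := ok (cell_layer c) => /forallP/(_ (cell_row c)).
    rewrite mem_layer; last exact: ltnW.
    rewrite cE (valP c) layer_locally_ssyt ?cE ?(valP c)//.
    have -> // : (cell_row c + cell_layer c + 1 - N)%N = j.
    by have /(congr1 snd) := cE.
  apply/eqP/ffunP => l; apply/ffunP => k; rewrite !ffunE.
  case: insubP => [c cD cE|cD].
    by rewrite ffunE; have [-> ->] := cell_layerK cE.
  have := ok l => /forallP/(_ k); rewrite mem_layer; last exact: ltnW.
  by rewrite (negbTE cD) => /eqP Gl; apply/val_inj.
rewrite okE; case: ifPn => [/forallP ok|]; last first.
  rewrite negb_forall => /existsP[l]; rewrite negb_forall => /existsP[k kbad].
  rewrite (bigD1 l)//= {1}/layer_kernel (bigD1 k)//=.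
  by move: kbad; case: ifP => _ /negbTE ->; rewrite !mul0r.
transitivity (\prod_(p : 'I_L * 'I_N.+1 | layer_cell p.1 p.2 \in D)
   (if odd p.1 then y else x) (G p.1 p.2)).
  rewrite (reindex_omap (fun c => (cell_layer c, cell_row c))
    (fun p => insub (layer_cell p.1 p.2))) /=; last first.
    move=> [l k] /= cD; rewrite insubT /=.
    by have [-> ->] := @cell_layerK l k (SeqSub cD) erefl.
  apply: eq_big => [c|c _].
    by rewrite layer_cellK (valP c) valK eqxx.
  have -> : (odd ((val c).1 + (val c).2) == odd N.+1) = ~~ odd (cell_layer c).
    by case: c => -[i j] /= cD; move: cD; rewrite memD; lia.
  by rewrite ffunE; case: odd.
rewrite -(pair_big_dep xpredT (fun (l : 'I_L) (k : 'I_N.+1) => layer_cell l k \in D)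
  (fun (l : 'I_L) (k : 'I_N.+1) => (if odd l then y else x) (G l k))) /=.
apply: eq_bigr => l _; rewrite /layer_kernel big_mkcond; apply: eq_bigr => k _.
have /forallP/(_ k) := ok l; rewrite mem_layer; last exact: ltnW.
by case: ifP => _ ->; rewrite ?mul1r.
Qed.

End Staircase.

(** * Truncation and limits *)

Lemma nth_rev_iota1 (m k : nat) : nth 0%N (rev (iota 1 m)) k = (m - k)%N.
Proof.
have [km|mk] := ltnP k m; last by rewrite nth_default ?size_rev ?size_iota//;
  lia.
by rewrite nth_rev size_iota// nth_iota; lia.
Qed.

Lemma mem_staircase (N n i j : nat) :
  ((i, j) \in skew_diagram (delta N%:Z) (delta n%:Z)) =
  [&& 0 < i, 0 < j, n + 2 <= i + j & i + j <= N + 1]%N.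
Proof.
by rewrite mem_skew_diagram /= size_rev size_iota !nth_rev_iota1; lia.
Qed.

Lemma checkerboard_filling_staircase (a b N n : nat) : (n < N)%N ->
  checkerboard_filling a b (skew_diagram (delta N%:Z) (delta n%:Z)) =
  [ffun c => if odd ((val c).1 + (val c).2) == odd N.+1 then b else a].
Proof.
move=> nN; set D := skew_diagram _ _.
have cornerE c : is_corner D c -> (c.1 + c.2 = N.+1)%N.
  by case: c => i j; rewrite /is_corner /= !mem_staircase; lia.
apply: xget_unique.
  split; first by exists (odd N.+1) => c; rewrite ffunE.
  by move=> c /cornerE cE; rewrite ffunE cE eqxx.
move=> k [[p kE] kcorner]; apply/ffunP => c; rewrite ffunE kE.
(* The corner [(N, 1)] fixes the parity class of [b], unless [a = b], when both classes agree. *)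
have cD : (N, 1%N) \in D by rewrite mem_staircase; lia.
have corner : is_corner D (val (SeqSub cD)).
  by rewrite /is_corner /= !mem_staircase; lia.
have := kcorner _ corner; rewrite kE (cornerE _ corner).
by clear kE; move: (odd (_ + _)) (odd N.+1) p => [] [] [] /=; congruence.
Qed.

Section Truncation.
Variables (R : realType) (D : seq (nat * nat)) (k : filling D).

Definition trunc_zeta (Mx : nat) : R :=
  \sum_(m : {ffun seq_sub D -> 'I_Mx.+1} | `[< ssyt (nat_filling m) >])
    \prod_c (m c)%:R ^- k c.

Let term (f : filling D) : \bar R := (\prod_c ((f c)%:R ^- k c))%:E.
Let bounded (Mx : nat) : set (filling D) :=
  [set f | ssyt f /\ forall c, (f c <= Mx)%N].

Let term_ge0 f : (0 <= term f)%E.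
Proof. by rewrite lee_fin prodr_ge0// => c _; rewrite invr_ge0 exprn_ge0. Qed.

Let esum_sub (A B : set (filling D)) : A `<=` B ->
  (\esum_(f in A) term f <= \esum_(f in B) term f)%E.
Proof.
move=> AB; apply: ereal_sup_le => _ [X [finX XA] <-].
by exists X => //; split => //; exact: subset_trans XA AB.
Qed.

Let trunc_zeta_esum Mx : (trunc_zeta Mx)%:E = \esum_(f in bounded Mx) term f.
Proof.
have -> : bounded Mx = @nat_filling D Mx @` [set m | ssyt (nat_filling m)].
  apply/seteqP; split => [f [fs fM]|_ [m ms <-]]; last first.
    by split => // c; rewrite ffunE -ltnS.
  have fE : nat_filling [ffun c => inord (f c) : 'I_Mx.+1] = f.
    by apply/ffunP => c; rewrite !ffunE inordK// ltnS.
  by exists [ffun c => inord (f c)] => //=; rewrite fE.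
rewrite esum_image; last first.
  by move=> m m' _ _ /ffunP e; apply/ffunP => c; apply/val_inj; have := e c;
    rewrite !ffunE.
rewrite (esum_fset finite_finset); last by move=> m _; exact: term_ge0.
rewrite /trunc_zeta -sumEFin.
have -> : [set m | ssyt (@nat_filling D Mx m)] =
  [set` [pred m : {ffun seq_sub D -> 'I_Mx.+1} | `[< ssyt (nat_filling m) >]]].
  by apply/seteqP; split => m /= /asboolP.
rewrite -(@bigfs _ _ _ _ (index_enum _)) ?index_enum_uniq//; last
  by move=> m _; rewrite mem_index_enum.
apply: eq_bigr => m _; rewrite /term; congr (_%:E).
by apply: eq_bigr => c _; rewrite ffunE.
Qed.

Lemma trunc_zeta_le_schur_zeta Mx : ((trunc_zeta Mx)%:E <= schur_zeta R k)%E.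
Proof. by rewrite trunc_zeta_esum; apply: esum_sub => f []. Qed.

Lemma trunc_zeta_nondecreasing : nondecreasing_seq trunc_zeta.
Proof.
move=> M M' MM'; rewrite -lee_fin !trunc_zeta_esum; apply: esum_sub.
by move=> f [fs fM]; split => // c; apply: leq_trans (fM c) _.
Qed.

(** A finite family of tableaux has bounded entries, so its sum is below some truncation; conversely
    every truncation is below the full sum. *)
Lemma schur_zeta_cvg (l : R) : trunc_zeta @ \oo --> l -> schur_zeta R k = l%:E.
Proof.
move=> cvl; apply/eqP; rewrite eq_le; apply/andP; split; last first.
  have := trunc_zeta_le_schur_zeta; case: (schur_zeta R k) => [s| |] le_s.
  - rewrite lee_fin; apply: (cvgr_to_le cvl); near=> M; rewrite -lee_fin.
    exact: le_s.
  - by rewrite leey.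
  - by have := le_s 0%N; rewrite leeNy_eq.
apply: ge_ereal_sup => _ [X [finX XA] <-].
have /finite_seqP[s XE] := finX.
pose M := (\max_(f <- s) \max_c (f : filling D) c)%N.
have XM : X `<=` bounded M.
  move=> f Xf; split; first exact: XA.
  move=> c; apply: leq_trans (leq_bigmax c) _.
  apply: (@leq_bigmax_seq _ s xpredT (fun g : filling D => \max_c g c)) => //.
  by move: Xf; rewrite XE.
apply: (@le_trans _ _ (trunc_zeta M)%:E).
  by rewrite trunc_zeta_esum; apply: ereal_sup_ubound; exists X.
rewrite lee_fin -(cvg_lim (@Rhausdorff R) cvl).
by apply: nondecreasing_cvgn_le;
  [exact: trunc_zeta_nondecreasing | apply/cvg_ex; exists l].
Unshelve. all: by end_near. Qed.

(** The uniform bound makes the value finite, so [fine] loses nothing. *)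
Lemma trunc_zeta_cvg (C : R) : (forall M, trunc_zeta M <= C) ->
  trunc_zeta @ \oo --> fine (schur_zeta R k).
Proof.
move=> bnd.
have cv : cvgn trunc_zeta.
  apply: nondecreasing_is_cvgn; first exact: trunc_zeta_nondecreasing.
  by exists C => _ [M _ <-].
by rewrite (schur_zeta_cvg cv).
Qed.

End Truncation.

Lemma cvg_det (R : realType) (n : nat) (A : nat -> 'M[R]_n) (B : 'M[R]_n) :
  (forall i j, (fun M => A M i j) @ \oo --> B i j) ->
  (fun M => \det (A M)) @ \oo --> \det B.
Proof.
move=> AB; rewrite /determinant.
apply: cvg_big => [|s _]; first exact: add_continuous.
apply: cvgM; first exact: cvg_cst.
apply: cvg_big => [|i _]; first exact: mul_continuous.
exact: AB.
Qed.

(** * Bounds and the determinant formulas *)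

Section Bounds.
Variable R : realType.

(** Telescoping with [1/u^2 <= 1/(u-1) - 1/u]; the [maxn] covers [M <= v], where the sum is
    empty. *)
Lemma sum_inv_sqr_tail (M v : nat) : (0 < v)%N ->
  \sum_(u < M.+1 | (v < u)%N) (u%:R : R) ^- 2 <= v%:R^-1 - (maxn v M)%:R^-1.
Proof.
move=> v_gt0; elim: M => [|M IH].
  by rewrite big_pred0 ?maxn0 ?subrr// => u; have := ltn_ord u; lia.
rewrite big_mkcond big_ord_recr /= -big_mkcond /=.
case: ifPn => vM; last first.
  by have -> : maxn v M.+1 = maxn v M; [lia | rewrite addr0].
have e1 : maxn v M = M by lia.
have e2 : maxn v M.+1 = M.+1 by lia.
rewrite e1 in IH; rewrite e2; apply: le_trans (lerD IH (lexx _)) _.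
have M0 : 0 < M%:R :> R by rewrite ltr0n; lia.
have -> : (M.+1%:R : R) ^- 2 = M%:R^-1 - M.+1%:R^-1 - (M%:R * M.+1%:R ^+ 2)^-1.
  by rewrite -natr1; field; rewrite natr1 !gt_eqF.
have : 0 <= (M%:R * M.+1%:R ^+ 2)^-1 :> R by rewrite invr_ge0 mulr_ge0.
move: (M%:R * _)^-1 (v%:R^-1) (M%:R^-1) (M.+1%:R^-1) => p q s t; lra.
Qed.

Lemma sum_inv_sqr_tail_le (M v : nat) : (0 < v)%N ->
  \sum_(u < M.+1 | (v < u)%N) (u%:R : R) ^- 2 <= v%:R^-1.
Proof.
move=> v_gt0; apply: le_trans (sum_inv_sqr_tail M v_gt0) _.
by rewrite lerBlDr lerDl invr_ge0.
Qed.

Lemma sum_inv_sqr_le2 (M : nat) :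
  \sum_(u < M.+1 | (0 < u)%N) (u%:R : R) ^- 2 <= 2.
Proof.
rewrite (bigID (fun u : 'I_M.+1 => (1 < u)%N)) /=.
have -> : 2 = 1%:R^-1 + 1 :> R by rewrite invr1.
apply: lerD.
  rewrite (eq_bigl (fun u : 'I_M.+1 => (1 < u)%N)); last by move=> u; lia.
  exact: sum_inv_sqr_tail_le.
case: M => [|M].
  by rewrite big_pred0// => u; have := ltn_ord u; lia.
rewrite (big_pred1 (inord 1)) ?inordK ?invr1 ?expr1n ?invr1//.
by move=> u; rewrite /= -val_eqE /= inordK//; lia.
Qed.

Lemma inv_exp_le (c d v : nat) : (c <= d)%N -> (0 < v)%N ->
  (v%:R : R) ^- d <= v%:R ^- c.
Proof.
move=> cd v0; have vp (e : nat) : 0 < (v%:R : R) ^+ e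
  by rewrite exprn_gt0 ?ltr0n.
by rewrite lef_pV2 ?posrE// ler_weXn2l// ler1n.
Qed.

Variables (a b : nat).
Local Notation wt c := (fun v : nat => (v%:R : R) ^- c).

Lemma trunc_zeta_staircase (N n r Mx : nat) : (n < N)%N ->
  N = (n + r.*2)%N \/ r.*2 = (N + n + 1)%N ->
  trunc_zeta R (checkerboard_filling a b
     (skew_diagram (delta N%:Z) (delta n%:Z))) Mx =
  layer_sign R N r r *
    \det (\matrix_(j < r, i < r) sink_entry N r Mx (wt b) (wt a) r j i).
Proof.
move=> nN rE.
have r_bounds : (0 < r <= N)%N by lia.
rewrite -(layer_sum_total _ _ r_bounds [ffun => ord0]).
rewrite -(staircase_sum_layers (mem_staircase N n) nN rE).
rewrite checkerboard_filling_staircase//.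
apply: eq_bigr => m _; apply: eq_bigr => c _; rewrite ffunE.
by case: ifP.
Qed.

(** The case [r = 1], a 1 by 1 determinant. Besides [N = n.+2], the hypotheses allow only the single
    cell [N = 1], [n = 0]. *)
Lemma trunc_zeta_ribbon (N n Mx : nat) : (n < N <= n.+2)%N -> (n.+1 = N -> n = 0%N) ->
  trunc_zeta R (checkerboard_filling a b
     (skew_diagram (delta N%:Z) (delta n%:Z))) Mx =
  ribbon_down Mx (wt b) (wt a) N.-1 0.
Proof.
move=> nN n0; rewrite (@trunc_zeta_staircase _ _ 1); [|lia|lia].
rewrite det_mx11 mxE /sink_entry /layer_sign big_ord1 /snk.
have -> : (nat_of_ord (@ord0 0) + 1 - N = 0)%N by rewrite /=; lia.
rewrite mul1r ifT; last by lia.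
by congr ribbon_down; rewrite /=; lia.
Qed.

Hypotheses (ha : (0 < a)%N) (hb : (2 <= b)%N).

(** The exponent [a] may be 1, so each [a]-cell is estimated together with the following [b]-cell:
    the pair costs at most the sum of [1/m^2], hence a factor 2. *)
Lemma ribbon_up_bounds (Mx e v : nat) :
  0 <= ribbon_up Mx (wt b) (wt a) e v <= 2 ^+ e.
Proof.
elim: e v => [|e IH] v; first by rewrite /= ler01 lexx.
have wt_ge0 c u : 0 <= wt c u by rewrite invr_ge0 exprn_ge0.
have inner_ge0 m : 0 <= \sum_(u < Mx.+1 | (m < u)%N)
    wt b u * ribbon_up Mx (wt b) (wt a) e u.
  by apply: sumr_ge0 => u _; apply: mulr_ge0 => //; have /andP[] := IH u.
apply/andP; split => /=.
  by apply: sumr_ge0 => m _; apply: mulr_ge0.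
apply: (@le_trans _ _ (\sum_(m < Mx.+1 | (0 < m)%N) (m%:R : R) ^- 2 * 2 ^+ e)).
  rewrite big_mkcond [leRHS]big_mkcond; apply: ler_sum => m _.
  case: (ltnP 0 m) => m0 //=; case: ifP => _; last first.
    by rewrite mulr_ge0 ?exprn_ge0.
  rewrite expr2 invfM -mulrA ler_pM//.
    by rewrite -[X in _ <= X^-1]expr1; exact: inv_exp_le.
  apply: le_trans (ler_wpM2r _ (sum_inv_sqr_tail_le Mx m0)); last exact: exprn_ge0.
  rewrite mulr_suml; apply: ler_sum => u mu; apply: ler_pM => //.
  - by have /andP[] := IH u.
  - by apply: inv_exp_le => //; lia.
  - by have /andP[] := IH u.
by rewrite -mulr_suml exprS ler_wpM2r ?exprn_ge0// sum_inv_sqr_le2.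
Qed.

Lemma ribbon_down_le (Mx e : nat) :
  ribbon_down Mx (wt b) (wt a) e 0 <= 2 ^+ e.+1.
Proof.
rewrite exprS; apply: le_trans (ler_wpM2r _ (sum_inv_sqr_le2 Mx)); last exact: exprn_ge0.
rewrite mulr_suml; apply: ler_sum => u u0; apply: ler_pM.
- by rewrite invr_ge0 exprn_ge0.
- by have /andP[] := ribbon_up_bounds Mx e u.
- exact: inv_exp_le.
- by have /andP[] := ribbon_up_bounds Mx e u.
Qed.

Lemma ribbon_down_cvg (e : nat) :
  (fun Mx => ribbon_down Mx (wt b) (wt a) e 0) @ \oo --> B R a b e%:Z.
Proof.
(* For [e = 0] both sides are the empty partition. *)
have nE : delta (e%:Z - 1) = delta e.-1%:Z.
  by case: e => // e; have -> : e.+1%:Z - 1 = e%:Z by lia.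
have tE : trunc_zeta R (checkerboard_filling a b
     (skew_diagram (delta e.+1%:Z) (delta e.-1%:Z))) =
   (fun Mx => ribbon_down Mx (wt b) (wt a) e 0).
  by apply/funext => Mx; rewrite trunc_zeta_ribbon//; lia.
rewrite /B /checkerboard_zeta nE addrC -intS -tE.
apply: (@trunc_zeta_cvg _ _ _ (2 ^+ e.+1)) => M.
by rewrite tE ribbon_down_le.
Qed.

Lemma checkerboard_zeta_staircase (N n r : nat) : (n < N)%N ->
  N = (n + r.*2)%N \/ r.*2 = (N + n + 1)%N ->
  checkerboard_zeta R a b (delta N%:Z) (delta n%:Z) =
  (layer_sign R N r r * \det (\matrix_(j < r, i < r)
     B R a b (i%:Z + j%:Z + 1 + N%:Z - r.*2%:Z)))%:E.
Proof.
move=> nN rE; apply: schur_zeta_cvg.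
rewrite (funext (fun M => trunc_zeta_staircase M nN rE)).
apply: cvgM; first exact: cvg_cst.
apply: cvg_det => j i; under eq_fun do rewrite mxE /sink_entry.
rewrite mxE; case: (boolP (r <= N - r + j + 1 + i)%N) => ri.
  have -> : i%:Z + j%:Z + 1 + N%:Z - r.*2%:Z = (N - r + j + 1 + i - r)%N%:Z
    by lia.
  exact: ribbon_down_cvg.
(* The sink precedes the source: the index is negative and both sides are 0. *)
rewrite /B ifF; first exact: cvg_cst.
by lia.
Qed.

End Bounds.

(** Here [N - r = r - n.+1]: the terms [snk s] vanish up to [s = N - r] and then run through
    [1, .., n]. *)
Lemma sum_snk (N n r : nat) : (n < N)%N -> r.*2 = (N + n + 1)%N ->
  (\sum_(s < r) snk N r s = (n * (n + 1))./2)%N.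
Proof.
move=> nN rE.
have tri d : (\sum_(s < N - r + d.+1) snk N r s = (d * d.+1)./2)%N.
  elim: d => [|d IH].
    rewrite big1// => s _; rewrite /snk; have := ltn_ord s; lia.
  by rewrite addnS big_ord_recr /= IH /snk; lia.
have e : (N - r + n.+1 = r)%N by lia.
by have := tri n; rewrite e addn1.
Qed.

Theorem theorem4p4 (R : realType) (a b N n : nat)
    (ha : (0 < a)%N) (hb : (2 <= b)%N) (hn : (n < N)%N) :
  ((N = n %[mod 2])%N ->
     checkerboard_zeta R a b (delta N%:Z) (delta n%:Z) =
     (\det (\matrix_(i < (N - n)./2, j < (N - n)./2)
              B R a b (i.+1%:Z + j.+1%:Z + n%:Z - 1)))%:E)
  /\
  ((N <> n %[mod 2])%N ->
     checkerboard_zeta R a b (delta N%:Z) (delta n%:Z) =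
     ((-1) ^+ (n * (n + 1))./2 *
      \det (\matrix_(i < (N + n + 1)./2, j < (N + n + 1)./2)
              B R a b (i.+1%:Z + j.+1%:Z - n%:Z - 2)))%:E).
Proof.
split=> Nn.
  have rE : N = (n + ((N - n)./2).*2)%N by lia.
  rewrite (checkerboard_zeta_staircase _ ha hb hn (or_introl rE)).
  (* Now [N - r = n + r], so every path starts before any path has ended, and the sign is 1. *)
  rewrite /layer_sign big1 ?mul1r => [|s _]; last first.
    by rewrite /snk; have := ltn_ord s; lia.
  congr (\det _)%:E; apply/matrixP => i j; rewrite !mxE; congr (B _ _ _ _); lia.
have rE : ((N + n + 1)./2).*2 = (N + n + 1)%N by lia.
rewrite (checkerboard_zeta_staircase _ ha hb hn (or_intror rE)).
rewrite /layer_sign (sum_snk hn rE).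
congr (_ * \det _)%:E; apply/matrixP => i j; rewrite !mxE; congr (B _ _ _ _);
  lia.
Qed.
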